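(* Let $N\ge 2$ be an integer. The Poincaré series $\mathcal{P}_3(\mathit{sl}_N,\mathbb{Q})$ (in the variables $q,t$) of the rational homology $H_{3}^{\mathrm{alg}}(\mathit{sl}_N,\mathbb{Q})$ is given by \begin{multline*} \mathcal{P}_3(\mathit{sl}_N,\mathbb{Q})\,(1-q^2)(1-q^4t^2)(1-q^6t^4) = 1-q^{2N}-q^{2N+2}t^2+q^{2N+4}(t^2+t^3-t^4)\\ +q^{2N+6}(t^4+t^5) -q^{4N+2}t^3-q^{4N+4}t^5-q^{4N+6}t^7+q^{4N+10}(t^7+t^8)-q^{6N+6}t^{8}. \end{multline*}
   Context: Let $\mathcal{H}_3=\mathbb{Q}[x_0,x_1,x_2]\otimes\Lambda(\xi_0,\xi_1,\xi_2)$ be the free supercommutative $\mathbb{Q}$-algebra with even (commuting) generators $x_0,x_1,x_2$ and odd (anticommuting, square-zero) generators $\xi_0,\xi_1,\xi_2$, bigraded (by additive $q$- and $t$-degrees) by $$\deg x_k=q^{2k+2}t^{2k},\qquad \deg\xi_k=q^{2N+2k}t^{2k+1},$$ meaning for example that $x_k$ has $q$-degree $2k+2$ and $t$-degree $2k$. The Koszul differential $d_N$ is the odd derivation (graded Leibniz rule) with $d_N(x_k)=0$ and $d_N(\xi_k)=\sum_{i_1+\cdots+i_N=k}x_{i_1}\cdots x_{i_N}$ (sum over ordered tuples of non-negative integers), that is, $$d_N(\xi_0)=x_0^N,\qquad d_N(\xi_1)=Nx_0^{N-1}x_1,\qquad d_N(\xi_2)=Nx_0^{N-1}x_2+\binom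 N2x_0^{N-2}x_1^2 .$$ It preserves $q$-degree and lowers $t$-degree by $1$. Set $H^{\mathrm{alg}}_3(\mathit{sl}_N,\mathbb{Q})=H(\mathcal{H}_3,d_N)$, a bigraded $\mathbb{Q}$-vector space. Its Poincaré series is $\sum_{a,b}\dim_{\mathbb{Q}} H_{(a,b)}\,q^at^b$, where $H_{(a,b)}$ is the component of $q$-degree $a$ and $t$-degree $b$. *)

(* Defs.v *)
From HB Require Import structures.
From mathcomp Require Import all_boot all_order all_algebra.
From mathcomp Require Import mpoly.
From mathcomp Require Import ring.

Set Implicit Arguments.
Unset Strict Implicit.
Unset Printing Implicit Defensive.

Import GRing.Theory.

Local Open Scope ring_scope.

(* Q[x_0, .., x_(n-1)] (x) Lambda(xi_0, .., xi_(n-1)), in the basis of the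
   increasing products xi_S = xi_(s_1) ... xi_(s_r), S = {s_1 < ... < s_r}:
   u stands for \sum_S (u S) xi_S. *)
Definition superpoly (n : nat) : Type := {ffun {set 'I_n} -> {mpoly rat[n]}}.

HB.instance Definition _ (n : nat) :=
  GRing.Lmodule.copy (superpoly n) {ffun {set 'I_n} -> {mpoly rat[n]}}.

Section Algebra.

Variable n : nat.
Implicit Types (A B C S : {set 'I_n}) (i j : 'I_n) (u v w : superpoly n).

Definition ninv A B : nat := (\sum_(a in A) \sum_(b in B) (b < a))%N.

(* xi_A xi_B = esign A B * xi_(A :|: B) for disjoint A and B *)
Definition esign A B : {mpoly rat[n]} := (-1) ^+ ninv A B.

Definition smul u v : superpoly n :=
  [ffun S : {set 'I_n} => \sum_(A : {set 'I_n} | A \subset S)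
               esign A (S :\: A) * u A * v (S :\: A)].

Definition sone : superpoly n := [ffun S : {set 'I_n} => (S == set0)%:R].

Lemma esignUl A S B : A \subset S ->
  esign S B = esign A B * esign (S :\: A) B.
Proof.
move=> sAS; rewrite /esign -exprD; congr (_ ^+ _).
by rewrite /ninv (big_setID A) /=; move/setIidPr: sAS => ->.
Qed.

Lemma esignUr A S B : A \subset S ->
  esign B S = esign B A * esign B (S :\: A).
Proof.
move=> sAS; rewrite /esign -exprD; congr (_ ^+ _).
rewrite /ninv -big_split /=; apply: eq_bigr => b _.
by rewrite (big_setID A) /=; move/setIidPr: sAS => ->.
Qed.

Lemma esign0l B : esign set0 B = 1.
Proof. by rewrite /esign /ninv big_set0. Qed.

Lemma esign0r B : esign B set0 = 1.
Proof. by rewrite /esign /ninv big1 // => b _; rewrite big_set0. Qed.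

Lemma esign_sqr A B : esign A B * esign A B = 1.
Proof. by rewrite /esign -exprD addnn -muln2 mulnC exprM sqrrN expr1n expr1n. Qed.

Lemma smulA : associative smul.
Proof.
move=> u v w; apply/ffunP=> S; rewrite !ffunE.
transitivity (\sum_(A : {set 'I_n} | A \subset S) \sum_(B : {set 'I_n} | B \subset A)
    esign A (S :\: A) * (esign B (A :\: B) * u B * v (A :\: B)) * w (S :\: A));
  last first.
  by apply: eq_bigr => A _; rewrite ffunE mulr_sumr mulr_suml.
rewrite (exchange_big_dep (fun B : {set 'I_n} => B \subset S)) /=; last first.
  by move=> A B sAS sBA; apply: subset_trans sAS.
apply: eq_bigr => B sBS; rewrite ffunE mulr_sumr.
rewrite [RHS](reindex_onto (fun C => B :|: C)
  (fun A : {set 'I_n} => A :\: B)) /=; last first.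
  by move=> A /andP[_ sBA]; rewrite setDE setUIr setUCr setIT; apply/setUidPr.
apply: eq_big => [C|C sC].
  apply/idP/idP.
    rewrite subsetD => /andP[sCS dCB]; rewrite subUset sBS sCS subsetUl /=.
    by rewrite setDUl setDv set0U; apply/eqP/setDidPl.
  case/andP => /andP[]; rewrite subUset => /andP[_ sCS] _ /eqP <-.
  by apply: setSD; rewrite subUset sBS.
have [sCS dCB] : C \subset S /\ [disjoint C & B].
  by apply/andP; rewrite -subsetD.
have eBC : (B :|: C) :\: B = C by rewrite setDUl setDv set0U; apply/setDidPl.
have eS : S :\: (B :|: C) = (S :\: B) :\: C by rewrite setDDl.
rewrite eBC eS (esignUl _ (subsetUl B C)) eBC (esignUr B sC); ring.
Qed.

Lemma smul1l : left_id sone smul.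
Proof.
move=> u; apply/ffunP=> S; rewrite ffunE (bigD1 set0) ?sub0set //= ffunE eqxx.
rewrite setD0 esign0l !mul1r big1 ?addr0 // => A /andP[_ /negPf nA].
by rewrite ffunE nA mulr0 mul0r.
Qed.

Lemma smul1r : right_id sone smul.
Proof.
move=> u; apply/ffunP=> S; rewrite ffunE (bigD1 S) //= ffunE setDv eqxx.
rewrite esign0r mul1r mulr1 big1 ?addr0 // => A /andP[sAS nA].
rewrite ffunE; suff /negPf -> : S :\: A != set0 by rewrite mulr0.
by apply: contraNneq nA => /eqP; rewrite setD_eq0 eqEsubset sAS.
Qed.

Lemma smulDl : left_distributive smul +%R.
Proof.
move=> u v w; apply/ffunP=> S; rewrite !ffunE -big_split /=.
by apply: eq_bigr => A _; rewrite ffunE; ring.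
Qed.

Lemma smulDr : right_distributive smul +%R.
Proof.
move=> u v w; apply/ffunP=> S; rewrite !ffunE -big_split /=.
by apply: eq_bigr => A _; rewrite ffunE; ring.
Qed.

Lemma sone_neq0 : sone != 0.
Proof.
by apply/eqP => /ffunP/(_ set0); rewrite !ffunE eqxx => /eqP; rewrite oner_eq0.
Qed.

Lemma esignC A B : [disjoint A & B] ->
  esign A B = (-1) ^+ (#|A| * #|B|) * esign B A.
Proof.
move=> dAB; suff e : (ninv A B + ninv B A = #|A| * #|B|)%N.
  by rewrite /esign -e exprD -mulrA -exprD addnn -muln2 mulnC exprM sqrrN
    !expr1n mulr1.
rewrite /ninv [X in (_ + X)%N]exchange_big -big_split /= -sum_nat_const.
apply: eq_bigr => a aA; rewrite -big_split /= -sum1_card.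
apply: eq_bigr => b bB; case: (ltngtP b a) => // /val_inj eab.
by move/disjointFr/(_ aA): dAB; rewrite -eab bB.
Qed.

End Algebra.

HB.instance Definition _ (n : nat) := GRing.Zmodule_isNzRing.Build (superpoly n)
  (@smulA n) (@smul1l n) (@smul1r n) (@smulDl n) (@smulDr n) (@sone_neq0 n).

Lemma superpolyM n (u v : superpoly n) (S : {set 'I_n}) : (u * v) S =
  \sum_(A : {set 'I_n} | A \subset S) esign A (S :\: A) * u A * v (S :\: A).
Proof. by rewrite ffunE. Qed.

Lemma superpoly_scaleAl n (c : rat) (u v : superpoly n) :
  c *: (u * v) = (c *: u) * v.
Proof.
apply/ffunP=> S; rewrite ffunE !superpolyM scaler_sumr; apply: eq_bigr => A _.
by rewrite ffunE -scalerAr -scalerAl.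
Qed.

HB.instance Definition _ (n : nat) :=
  GRing.Lmodule_isLalgebra.Build rat (superpoly n) (@superpoly_scaleAl n).

Lemma superpoly_scaleAr n (c : rat) (u v : superpoly n) :
  c *: (u * v) = u * (c *: v).
Proof.
apply/ffunP=> S; rewrite ffunE !superpolyM scaler_sumr; apply: eq_bigr => A _.
by rewrite ffunE -scalerAr.
Qed.

HB.instance Definition _ (n : nat) :=
  GRing.Lalgebra_isAlgebra.Build rat (superpoly n) (@superpoly_scaleAr n).

Definition sx n (k : 'I_n) : superpoly n := [ffun S : {set 'I_n} => if S == set0 then 'X_k else 0].
Definition sxi n (k : 'I_n) : superpoly n := [ffun S : {set 'I_n} => (S == [set k])%:R].

Definition has_parity n (p : bool) (u : superpoly n) : Prop :=
  forall S : {set 'I_n}, u S != 0 -> odd #|S| = p.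

Lemma parity_sign n p (u : superpoly n) (S : {set 'I_n}) : has_parity p u ->
  (-1) ^+ p * u S = (-1) ^+ #|S| * u S.
Proof.
move=> up; have [->|/up <-] := eqVneq (u S) 0; first by rewrite !mulr0.
by rewrite signr_odd.
Qed.

Lemma superpoly_signE n (p : bool) (u : superpoly n) (S : {set 'I_n}) :
  ((-1) ^+ p * u) S = (-1) ^+ p * u S.
Proof. by rewrite !mulr_sign; case: p => //; rewrite ffunE. Qed.

Lemma superpoly_supercomm n (p r : bool) (u v : superpoly n) :
  has_parity p u -> has_parity r v -> u * v = (-1) ^+ (p && r) * (v * u).
Proof.
move=> up vr; apply/ffunP=> S; rewrite superpoly_signE !superpolyM mulr_sumr.
rewrite (reindex_onto (fun A => S :\: A) (fun A => S :\: A)) /=; last first.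
  by move=> A sAS; rewrite setDDr setDv set0U; apply/setIidPr.
apply: eq_big => [A|A].
  rewrite subsetDl setDDr setDv set0U /=; apply/eqP/idP => [<-|]; last first.
    by move/setIidPr.
  exact: subsetIl.
case/andP=> _ /eqP eA; rewrite eA esignC; last first.
  by rewrite disjoint_subset; apply/subsetP => x; rewrite !inE => /andP[].
have [u0|u0] := eqVneq (u (S :\: A)) 0; first by rewrite u0 !(mulr0, mul0r).
have [v0|v0] := eqVneq (v A) 0; first by rewrite v0 !(mulr0, mul0r).
rewrite -(signr_odd _ (_ * _)) oddM (up _ u0) (vr _ v0); ring.
Qed.

Lemma sxi_sqr n (k : 'I_n) : sxi k * sxi k = 0.
Proof.
apply/ffunP=> S; rewrite superpolyM [RHS]ffunE big1 // => A sAS; rewrite !ffunE.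
case: eqP => [->|_]; last by rewrite mulr0 mul0r.
case: eqP => [/setP/(_ k)|_]; last by rewrite mulr0.
by rewrite !inE eqxx.
Qed.

(* Exponents of x_k and xi_k contribute deg x_k = q^(2k+2) t^(2k) and
   deg xi_k = q^(2N+2k) t^(2k+1) to the bidegree of x^m xi_S. *)
Definition qdeg (N n : nat) (m : 'X_{1..n}) (S : {set 'I_n}) : nat :=
  (\sum_(k < n) m k * (2 * k + 2) + \sum_(k in S) (2 * N + 2 * k))%N.
Definition tdeg (n : nat) (m : 'X_{1..n}) (S : {set 'I_n}) : nat :=
  (\sum_(k < n) m k * (2 * k) + \sum_(k in S) (2 * k + 1))%N.

Definition bihomog (N n a b : nat) (u : superpoly n) : Prop :=
  forall (S : {set 'I_n}) (m : 'X_{1..n}), m \in msupp (u S) ->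
    qdeg N m S = a /\ tdeg m S = b.

(* In koszul_sxi the index tuples have entries < n, which loses nothing: an N-tuple
   of natural numbers with sum k < n has all its entries <= k. *)
Record is_koszul_differential (N n : nat) (d : {linear superpoly n -> superpoly n})
    : Prop := IsKoszulDifferential {
  koszul_odd : forall (p : bool) (u : superpoly n),
    has_parity p u -> has_parity (~~ p) (d u);
  koszul_leibniz : forall (p : bool) (u v : superpoly n), has_parity p u ->
    d (u * v) = d u * v + (-1) ^+ p * (u * d v);
  koszul_sx : forall k : 'I_n, d (sx k) = 0;
  koszul_sxi : forall k : 'I_n, d (sxi k) =
    \sum_(i : {ffun 'I_N -> 'I_n} | (\sum_(j < N) i j == k)%N)
      \prod_(j < N) sx (i j)
}.

Section Existence.

Variables N n : nat.
Implicit Types (A S : {set 'I_n}) (i k : 'I_n) (u v : superpoly n).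

Let f (k : 'I_n) : {mpoly rat[n]} :=
  \sum_(i : {ffun 'I_N -> 'I_n} | (\sum_(j < N) i j == k)%N)
    \prod_(j < N) 'X_(i j).

Definition koszul u : superpoly n :=
  [ffun S : {set 'I_n} => \sum_(i | i \notin S) esign [set i] S * f i * u (i |: S)].

Lemma koszul_linear : linear koszul.
Proof.
move=> c u v; apply/ffunP=> S; rewrite !ffunE scaler_sumr -big_split /=.
by apply: eq_bigr => i _; rewrite !ffunE mulrDr scalerAr.
Qed.

HB.instance Definition _ :=
  GRing.isLinear.Build rat (superpoly n) (superpoly n) *:%R koszul koszul_linear.

Lemma big_setU1_in i S (F : {set 'I_n} -> {mpoly rat[n]}) :
  \sum_(A : {set 'I_n} | (A \subset i |: S) && (i \in A)) F A =
  \sum_(A : {set 'I_n} | (A \subset S) && (i \notin A)) F (i |: A).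
Proof.
rewrite (reindex_onto (fun A => i |: A) (fun A => A :\ i)) /=; last first.
  by move=> A /andP[_ iA]; rewrite setD1K.
apply: eq_bigl => A; rewrite setU11 andbT.
apply/andP/andP => [[sA /eqP eA]|[sA iA]].
  have iA : i \notin A by rewrite -eA !inE eqxx.
  by split=> //; rewrite -eA; apply: subset_trans (setSD _ sA) _;
     rewrite setDUl setDv set0U subsetDl.
by rewrite setUS // setU1K.
Qed.

Lemma koszulM p u v : has_parity p u ->
  koszul (u * v) = koszul u * v + (-1) ^+ p * (u * koszul v).
Proof.
move=> up; apply/ffunP=> S; rewrite [RHS]ffunE superpoly_signE !superpolyM ffunE.
have -> : \sum_(A : {set 'I_n} | A \subset S)
     esign A (S :\: A) * koszul u A * v (S :\: A) =
   \sum_i \sum_(A : {set 'I_n} | (A \subset S) && (i \notin A))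
     f i * (esign A (S :\: A) * esign [set i] A * u (i |: A) * v (S :\: A)).
  rewrite (exchange_big_dep (fun A : {set 'I_n} => A \subset S)) /=; last first.
    by move=> i A _ /andP[].
  apply: eq_bigr => A sA; rewrite ffunE mulr_sumr mulr_suml.
  by apply: eq_big => [i|i _]; rewrite ?sA //; ring.
have -> : (-1) ^+ p * (\sum_(A : {set 'I_n} | A \subset S)
     esign A (S :\: A) * u A * koszul v (S :\: A)) =
   \sum_i \sum_(A : {set 'I_n} | (A \subset S) && (i \notin S :\: A))
     f i * ((-1) ^+ #|A| * esign A (S :\: A) * esign [set i] (S :\: A) * u A
            * v (i |: (S :\: A))).
  rewrite (exchange_big_dep (fun A : {set 'I_n} => A \subset S)) /=; last first.
    by move=> i A _ /andP[].
  rewrite mulr_sumr; apply: eq_bigr => A sA; rewrite ffunE !mulr_sumr.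
  apply: eq_big => [i|i _]; rewrite ?sA //.
  transitivity (f i * (((-1) ^+ p * u A) * esign A (S :\: A) *
     esign [set i] (S :\: A) * v (i |: (S :\: A)))); first by ring.
  by rewrite parity_sign //; ring.
rewrite -big_split /= big_mkcond; apply: eq_bigr => i _.
have esi A : i \notin A -> esign A [set i] = (-1) ^+ #|A| * esign [set i] A.
  by move=> iA; rewrite esignC ?cards1 ?muln1 // disjoint_sym disjoints1.
have sD (A B : {set 'I_n}) : [disjoint A & B] -> (A :|: B) :\: A = B.
  by move=> dAB; rewrite setDUl setDv set0U; apply/setDidPl; rewrite disjoint_sym.
have dI (A : {set 'I_n}) : i \notin A -> [disjoint [set i] & A] by rewrite disjoints1.
case: ifPn => [iS|]; last first.
  rewrite negbK => iS; apply/esym.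
  have eS : S = i |: S by apply/esym/setUidPr; rewrite sub1set.
  rewrite [X in _ + X](eq_bigl (fun A : {set 'I_n} => (A \subset i |: S) && (i \in A)));
    last by move=> A; rewrite -eS !inE iS andbT negbK.
  rewrite big_setU1_in -big_split big1 //= => A /andP[sA iA].
  have iD : i \in S :\: A by rewrite !inE iA.
  have -> : S :\: (i |: A) = (S :\: A) :\ i by rewrite setUC setDDl.
  rewrite setD1K //; set B := S :\: A in iD *.
  have sB : [set i] \subset B by rewrite sub1set.
  rewrite (esignUr A sB) (esignUl (B :\ i) (subsetUl [set i] A)) sD ?dI //.
  rewrite esi // cardsU1 iA /= exprS.
  set s := (-1) ^+ #|A|; set a := esign [set i] A; set b := esign A _.
  set e := esign _ _; have ee : e * e = 1 by exact: esign_sqr.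
  have aa : a * a = 1 by exact: esign_sqr.
  transitivity (f i * s * b * u (i |: A) * v B * (a * a - e * e)); first by ring.
  by rewrite aa ee subrr mulr0.
rewrite superpolyM mulr_sumr (bigID (fun A => i \in A)) /= big_setU1_in.
congr (_ + _).
  apply: eq_bigr => A /andP[sA iA].
  have -> : (i |: S) :\: (i |: A) = S :\: A.
    apply/setP=> x; rewrite !inE; case: (x =P i) => //= ->.
    by rewrite (negPf iS) andbF.
  rewrite (esignUl (S :\: A) (subsetUl [set i] A)) sD ?dI //.
  rewrite (esignUr [set i] sA).
  set a := esign [set i] A; set e := esign [set i] (S :\: A).
  have ee : e * e = 1 by exact: esign_sqr.
  transitivity (f i * (esign A (S :\: A) * a * u (i |: A) * v (S :\: A)) * (e * e));
    first by ring.
  by rewrite ee mulr1.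
apply: eq_big => [A|A /andP[sA iA]].
  rewrite !inE (negPf iS) andbF andbT; apply/andP/idP => [[sA iA]|sA].
    apply/subsetP => x xA; move/subsetP/(_ x xA): sA; rewrite !inE.
    by case: eqP xA => // ->; rewrite (negPf iA).
  by rewrite (subset_trans sA (subsetUr _ _)); split=> //; apply: contra iS;
     apply: (subsetP sA).
have sAS : A \subset S.
  apply/subsetP => x xA; move/subsetP/(_ x xA): sA; rewrite !inE.
  by case: eqP xA => // ->; rewrite (negPf iA).
have -> : (i |: S) :\: A = i |: (S :\: A).
  by apply/setP=> x; rewrite !inE; case: (x =P i) => // ->; rewrite iA.
have iB : i \notin S :\: A by rewrite !inE (negPf iS) andbF.
rewrite (esignUr [set i] sAS) (esignUr A (subsetUl [set i] (S :\: A))) sD ?dI //.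
rewrite esi //; set a := esign [set i] A.
have aa : a * a = 1 by exact: esign_sqr.
transitivity (f i * ((-1) ^+ #|A| * esign A (S :\: A) * esign [set i] (S :\: A)
   * u A * v (i |: S :\: A)) * (a * a)); first by ring.
by rewrite aa mulr1.
Qed.

Let emb (c : {mpoly rat[n]}) : superpoly n :=
  [ffun S : {set 'I_n} => if S == set0 then c else 0].

Lemma koszul_differential_exists :
  exists d : {linear superpoly n -> superpoly n}, is_koszul_differential N d.
Proof.
exists koszul; split=> [p u up S|p u v|k|k].
- rewrite ffunE => /eqP dS.
  have [i iS ui] : exists2 i, i \notin S & u (i |: S) != 0.
    apply/exists_inP; apply: contra_notT dS; rewrite negb_exists => /forallP u0.
    rewrite big1 // => i iS; move: (u0 i); rewrite iS /= negbK => /eqP ->.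
    by rewrite mulr0.
  by rewrite -(up _ ui) cardsU1 iS /= negbK.
- exact: koszulM.
- apply/ffunP=> S; rewrite !ffunE big1 // => i _; rewrite ffunE.
  case: eqP => [/setP/(_ i)|_]; last by rewrite mulr0.
  by rewrite !inE eqxx.
have emb1 : emb 1 = 1.
  by apply/ffunP=> S; rewrite !ffunE; case: eqP.
have embM : {morph emb : x y / x * y}.
  move=> x y; apply/ffunP=> S; rewrite superpolyM (bigD1 set0) ?sub0set //=.
  rewrite esign0l mul1r big1 ?addr0; last first.
    by move=> A /andP[_ /negPf nA]; rewrite ffunE nA mulr0 mul0r.
  by rewrite !ffunE setD0 eqxx; case: eqP => //; rewrite mulr0.
have embD : {morph emb : x y / x + y}.
  by move=> x y; apply/ffunP=> S; rewrite !ffunE; case: eqP; rewrite ?addr0.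
have emb0 : emb 0 = 0 by apply/ffunP=> S; rewrite !ffunE if_same.
transitivity (emb (f k)); last first.
  rewrite (big_morph _ embD emb0); apply: eq_bigr => i _.
  by rewrite (big_morph _ embM emb1).
apply/ffunP=> S; rewrite !ffunE; case: eqP => [->|S0].
  rewrite (bigD1 k) ?inE //= ffunE setU0 eqxx esign0r mul1r mulr1.
  rewrite big1 ?addr0 // => i /andP[_ ik]; rewrite ffunE setU0.
  by rewrite (inj_eq set1_inj) (negPf ik) mulr0.
rewrite big1 // => i iS; rewrite ffunE; case: eqP => [e|_]; last by rewrite mulr0.
case: S0; apply/setP=> x; rewrite inE; apply/negP => xS.
have /set1P ex : x \in [set k] by rewrite -e !inE xS orbT.
have /set1P ei : i \in [set k] by rewrite -e !inE eqxx.
by move: iS; rewrite ei -ex xS.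
Qed.

End Existence.

(* For linear subspaces Z and B, dim (Z / (Z :&: B)) = r: the classes of the
   vectors e i form a basis of that quotient. *)
Definition subquotient_dim (V : lmodType rat) (Z B : V -> Prop) (r : nat) : Prop :=
  exists e : 'I_r -> V, (forall i, Z (e i)) /\
    forall z, Z z -> exists! c : {ffun 'I_r -> rat}, B (z - \sum_(i < r) c i *: e i).

(* dim H_(a,b) = r for H = ker d / im d *)
Definition homology_dim (N n : nat) (d : superpoly n -> superpoly n)
    (a b r : nat) : Prop :=
  subquotient_dim (fun z => d z = 0 /\ bihomog N a b z)
                  (fun z => exists w, z = d w) r.

(* P a b is the coefficient of q^a t^b *)
Definition is_poincare_series (N n : nat) (d : superpoly n -> superpoly n)
    (P : nat -> nat -> nat) : Prop :=
  forall a b : nat, homology_dim N d a b (P a b).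

(* In {poly {poly int}} the outer variable is q and the inner one t, so that
   p`_a`_b is the coefficient of q^a t^b. *)
Notation qvar := ('X : {poly {poly int}}).
Notation tvar := (('X)%:P : {poly {poly int}}).

(* coefficient of q^a t^b in the product of the power series P and p *)
Definition series_mul_coef (P : nat -> nat -> nat) (p : {poly {poly int}})
    (a b : nat) : int :=
  \sum_(i < a.+1) \sum_(j < b.+1) (P i j)%:Z * p`_(a - i)`_(b - j).

(* Main.v *)
Require Import Defs.
From HB Require Import structures.
From mathcomp Require Import all_boot all_order all_algebra.
From mathcomp Require Import mpoly.
From mathcomp Require Import ring zify.

Set Implicit Arguments.
Unset Strict Implicit.
Unset Printing Implicit Defensive.

Import GRing.Theory Num.Theory.
Local Open Scope ring_scope.

(* Write d(xi_k) = x0^(N-2) h_k with h_0 = x0^2, h_1 = N x0 x1 and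
   h_2 = N x0 x2 + C(N,2) x1^2.  The factor x0^(N-2) does not affect the kernel, and
   (h_0, h_1, h_2) has the Hilbert-Burch resolution, so ker d is a free module over
   Q[x0,x1,x2] on the bihomogeneous cycles
     1,  N x1 xi_0 - x0 xi_1,  N x2 xi_0 + (N-1)/2 x1 xi_1 - x0 xi_2  and
     h_2 xi_0 xi_1 - h_1 xi_0 xi_2 + h_0 xi_1 xi_2.
   If Z and C are the numerators of the Hilbert series of ker d and of the whole
   complex, rank-nullity for d, which lowers the t-degree by one, gives
   Z - (C - Z) / t as numerator of the Poincare series of the homology. *)

(** * Dimensions of subspaces and of subquotients *)

(** Coordinates by row vectors bring the rank theory of matrices to finite-dimensional subspaces of
    the infinite-dimensional space of superpolynomials. *)
Definition has_dim (V : lmodType rat) (W : V -> Prop) (n : nat) : Prop :=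
  exists2 f : {linear 'rV[rat]_n -> V}, injective f &
    forall v, W v <-> exists u, v = f u.

Lemma has_dim_ext (V : lmodType rat) (W W' : V -> Prop) n :
  (forall v, W v <-> W' v) -> has_dim W n -> has_dim W' n.
Proof.
by move=> eW [f f_inj fW]; exists f => // v; rewrite -eW.
Qed.

Lemma has_dim_image (U V : lmodType rat) (g : {linear U -> V}) (W : U -> Prop) n :
  injective g -> has_dim W n -> has_dim (fun v => exists2 u, W u & v = g u) n.
Proof.
move=> g_inj [f f_inj fW]; exists (g \o f : {linear _ -> _}).
  exact: inj_comp.
move=> v; split=> [[u /fW[x ->] ->]|[x ->]]; first by exists x.
by exists (f x) => //; apply/fW; exists x.
Qed.

(** Row i of [M] is a chosen lift of the i-th basis vector; this turns maps between subspaces with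
    coordinates into matrices. *)
Lemma linear_lift_mx (V : lmodType rat) n m (f : {linear 'rV[rat]_n -> V})
    (g : {linear 'rV[rat]_m -> V}) :
  (forall u, exists v, f u = g v) ->
  exists M : 'M[rat]_(n, m), forall u, f u = g (u *m M).
Proof.
move=> fg; have [r rE] := fin_all_exists (fun i : 'I_n => fg (delta_mx 0 i)).
exists (\matrix_i r i) => u; rewrite {1}[u]row_sum_delta mulmx_sum_row !linear_sum.
by apply: eq_bigr => i _; rewrite !linearZ rowK rE.
Qed.

(** By rank-nullity d has rank c - k on C. The last hypothesis makes d(C) all the boundaries in Z,
    so they have codimension z - (c - k) there; the inequality makes the truncated subtraction
    exact. *)
Lemma subquotient_dim_rank (V : lmodType rat) (d : {linear V -> V})
    (C Z : V -> Prop) c z k :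
  has_dim C c -> has_dim Z z -> has_dim (fun v => C v /\ d v = 0) k ->
  (forall v, C v -> Z (d v)) ->
  (forall v, Z v -> (exists w, v = d w) -> exists2 w, C w & v = d w) ->
  (c <= z + k)%N /\ subquotient_dim Z (fun v => exists w, v = d w) (z + k - c).
Proof.
move=> [fc fcI fcE] [fz fzI fzE] [fk fkI fkE] dCZ ZdC.
have Cfc u : C (fc u) by apply/fcE; exists u.
have Zfz u : Z (fz u) by apply/fzE; exists u.
have [M ME] : exists M : 'M[rat]_(c, z), forall u, (d \o fc) u = fz (u *m M).
  by apply: linear_lift_mx => u; apply/fzE/dCZ.
have [W WE] : exists W : 'M[rat]_(k, c), forall u, fk u = fc (u *m W).
  apply: linear_lift_mx => u; apply/fcE.
  by have /fkE[] : exists u', fk u = fk u' by exists u.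
have W_free : row_free W.
  rewrite -kermx_eq0; apply/rowV0P => u /sub_kermxP uW.
  by apply: fkI; rewrite WE uW !linear0.
have kerM : (W :=: kermx M)%MS.
  apply/eqmxP/andP; split.
    apply/sub_kermxP/row_matrixP => i; rewrite row_mul row0.
    apply: fzI; rewrite -ME /= rowE -WE linear0.
    by have /fkE[] : exists u', fk (delta_mx 0 i) = fk u' by exists (delta_mx 0 i).
  apply/rV_subP => u /sub_kermxP uM.
  have /fkE[x xE] : C (fc u) /\ d (fc u) = 0.
    by split=> //; move: (ME u); rewrite /= uM linear0.
  by have -> : u = x *m W; [apply: fcI; rewrite xE WE | exact: submxMl].
have rkM : (\rank M + k = c)%N.
  have := mxrank_ker M; rewrite -kerM (eqP W_free) => ->.
  by rewrite subnKC // rank_leq_row.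
have rkC : \rank M^C%MS = (z + k - c)%N by rewrite mxrank_compl -(subnDr k) rkM.
split; first by have := rank_leq_col M; rewrite -(leq_add2r k) rkM.
(* A basis of the complement [M^C] of the image represents a basis of the quotient. *)
rewrite -rkC; exists (fun i => fz (row i (row_base M^C%MS))); split=> [i|v /fzE[u ->]].
  exact: Zfz.
have sumE (x : {ffun 'I_(\rank M^C%MS) -> rat}) :
    \sum_i x i *: fz (row i (row_base M^C%MS)) =
    fz ((\row_i x i) *m row_base M^C%MS).
  rewrite mulmx_sum_row linear_sum; apply: eq_bigr => i _.
  by rewrite linearZ mxE.
(* In coordinates, a boundary is a vector of the row space of [M]. *)
have BE u' : (exists w, fz u' = d w) <-> (u' <= M)%MS.
  split=> [/(ZdC _ (Zfz _))[w /fcE[x ->]]|/submxP[x ->]]; last first.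
    by exists (fc x); rewrite -ME.
  by move: (ME x) => /= -> /fzI ->; rewrite submxMl.
have [x xE] : exists x : 'rV_(\rank M^C%MS), (u - x *m row_base M^C%MS <= M)%MS.
  have : (u <= M + M^C)%MS by rewrite submx_full ?addsmx_compl_full.
  case/sub_addsmxP => -[a b] /= ->.
  have /submxP[x ->] : (b *m M^C <= row_base M^C)%MS by rewrite eq_row_base submxMl.
  by exists x; rewrite addrK submxMl.
exists [ffun i => x 0 i]; split.
  rewrite sumE -linearB BE; congr (_ <= _)%MS: xE; congr (_ - _ *m _).
  by apply/rowP => i; rewrite mxE ffunE.
move=> y; rewrite sumE -linearB BE => yE.
apply/ffunP => i; rewrite ffunE; set y' := \row_i y i in yE.
suff -> : x = y' by rewrite mxE.
apply/eqP; rewrite -subr_eq0; apply/eqP.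
apply: (row_free_inj (row_base_free M^C%MS)); rewrite mul0mx.
(* Two solutions differ by a vector lying both in the image and in its complement. *)
have capM : (M :&: M^C = 0)%MS by exact: capmx_compl.
apply/eqP; rewrite -submx0 -capM sub_capmx; apply/andP; split; last first.
  by rewrite -(eq_row_base M^C%MS) submxMl.
have -> : (x - y') *m row_base M^C%MS
    = (u - y' *m row_base M^C%MS) - (u - x *m row_base M^C%MS).
  by rewrite mulmxBl opprB [RHS]addrC addrA subrK.
by apply: addmx_sub; rewrite // eqmx_opp.
Qed.

(** * Homogeneous families of polynomials *)

Section HomogeneousComponents.

Variable n : nat.
Implicit Types (m : 'X_{1..n}) (p q : {mpoly rat[n]}) (Q : pred 'X_{1..n}).

Definition mproj Q p : {mpoly rat[n]} := \sum_(m <- msupp p | Q m) p@_m *: 'X_[m].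

Lemma mcoeff_mproj Q p m : (mproj Q p)@_m = if Q m then p@_m else 0.
Proof.
have sE m' : (p@_m' *: 'X_[m'])@_m = if m' == m then p@_m else 0.
  by rewrite mcoeffZ mcoeffX; case: eqP => [->|_]; rewrite ?mulr1 ?mulr0.
rewrite /mproj raddf_sum /= (eq_bigr _ (fun m' _ => sE m')) -big_mkcondr /=.
have [m_p|/memN_msupp_eq0 p0] := boolP (m \in msupp p); last first.
  by rewrite p0 big1 ?if_same.
rewrite big_mkcond (bigD1_seq m) ?msupp_uniq //= eqxx andbT big1 ?addr0 //.
by move=> m' /negPf ->; rewrite andbF.
Qed.

Lemma mproj_linear Q : linear (mproj Q).
Proof.
move=> c p q; apply/mpolyP => m.
rewrite !(mcoeffD, mcoeffZ, mcoeff_mproj).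
by case: (Q m); rewrite ?mulr0 ?addr0.
Qed.

HB.instance Definition _ Q :=
  GRing.isLinear.Build rat {mpoly rat[n]} {mpoly rat[n]} *:%R (mproj Q) (mproj_linear Q).

Lemma msupp_mproj Q p m : m \in msupp (mproj Q p) -> Q m.
Proof. by rewrite mcoeff_msupp mcoeff_mproj; case: (Q m) => //; rewrite eqxx. Qed.

Lemma mproj_id Q p : {in msupp p, forall m, Q m} -> mproj Q p = p.
Proof.
move=> pQ; apply/mpolyP => m; rewrite mcoeff_mproj.
by case: ifPn => // nQ; rewrite memN_msupp_eq0 //; apply: contra nQ => /pQ.
Qed.

Lemma mproj_eq0 Q p : {in msupp p, forall m, ~~ Q m} -> mproj Q p = 0.
Proof.
move=> pQ; apply/mpolyP => m; rewrite mcoeff_mproj mcoeff0.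
by case: ifPn => // mQ; rewrite memN_msupp_eq0 //; apply: contraL mQ => /pQ.
Qed.

(** Split q into its part on [Q'] and the rest: multiplied by p, the first part has only monomials
    in [Q] and the second has none. *)
Lemma mprojM Q Q' p q :
  (forall m m', m \in msupp p -> Q (m + m')%MM = Q' m') ->
  mproj Q (p * q) = p * mproj Q' q.
Proof.
move=> pQ; have -> : p * q = p * mproj Q' q + p * mproj (predC Q') q.
  rewrite -mulrDr; congr (_ * _); apply/mpolyP => m.
  by rewrite mcoeffD !mcoeff_mproj /=; case: (Q' m); rewrite ?addr0 ?add0r.
rewrite linearD /= [X in X + _]mproj_id; first rewrite [X in _ + X]mproj_eq0 ?addr0 //.
  move=> m /msuppM_le/allpairsP[[m1 m2] /= [m1p /msupp_mproj m2q ->]].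
  by rewrite pQ.
move=> m /msuppM_le/allpairsP[[m1 m2] /= [m1p /msupp_mproj m2q ->]].
by rewrite pQ.
Qed.

(** [e] enumerates the allowed pairs of an index and a monomial; the coefficients there are the
    coordinates. *)
Lemma has_dim_monomials (T : finType) (Q : T -> pred 'X_{1..n}) r
    (e : 'I_r -> T * 'X_{1..n}) :
  injective e -> (forall t m, Q t m <-> exists i, e i = (t, m)) ->
  has_dim (fun u : {ffun T -> {mpoly rat[n]}} =>
    forall t m, m \in msupp (u t) -> Q t m) r.
Proof.
move=> e_inj eQ.
pose f (u : 'rV[rat]_r) : {ffun T -> {mpoly rat[n]}} :=
  [ffun t => \sum_i (if (e i).1 == t then u 0 i else 0) *: 'X_[(e i).2]].
have f_lin : linear f.
  move=> c u v; apply/ffunP => t; rewrite !ffunE scaler_sumr -big_split /=.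
  apply: eq_bigr => i _; rewrite scalerA -scalerDl !mxE.
  by case: eqP; rewrite ?mulr0 ?addr0.
have f_coef u t m : (f u t)@_m = \sum_i (if e i == (t, m) then u 0 i else 0).
  rewrite ffunE raddf_sum; apply: eq_bigr => i _ /=.
  rewrite mcoeffZ mcoeffX -pair_eqE /pair_eq /=.
  by case: (_ == t) => /=; rewrite ?mul0r //; case: eqP; rewrite ?mulr1 ?mulr0.
have f_coefe u i : (f u (e i).1)@_(e i).2 = u 0 i.
  rewrite f_coef (bigD1 i) //= -surjective_pairing eqxx big1 ?addr0 // => j ji.
  by rewrite (inj_eq e_inj) (negPf ji).
pose fL : {linear 'rV[rat]_r -> {ffun T -> {mpoly rat[n]}}} := HB.pack f
  (GRing.isLinear.Build rat 'rV[rat]_r {ffun T -> {mpoly rat[n]}} *:%R f f_lin).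
exists fL => [u v /= uv|v].
  by apply/rowP => i; rewrite -!f_coefe uv.
split=> [vQ|[u ->] t m]; last first.
  rewrite mcoeff_msupp f_coef => s0; apply/eQ.
  have [i /eqP ei|ne] := pickP (fun i => e i == (t, m)); first by exists i.
  by rewrite big1 ?eqxx // in s0 => i _; rewrite ne.
exists (\row_i (v (e i).1)@_(e i).2); apply/ffunP => t; apply/mpolyP => m.
have [/vQ/eQ[i ei]|/[dup] vtm /memN_msupp_eq0 ->] := boolP (m \in msupp (v t)).
  by have := f_coefe (\row_i (v (e i).1)@_(e i).2) i; rewrite ei mxE ei.
rewrite f_coef big1 // => i _; case: eqP => // ei; rewrite mxE ei /=.
exact: memN_msupp_eq0.
Qed.

(** Bounding the exponents by [K] places the allowed monomials in a finite type, so that the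
    dimension is a cardinal. *)
Lemma has_dim_bounded_monomials (T : finType) (Q : T -> pred 'X_{1..n}) K :
  (forall t m, Q t m -> forall i, m i < K)%N ->
  has_dim (fun u : {ffun T -> {mpoly rat[n]}} =>
      forall t m, m \in msupp (u t) -> Q t m)
    #|[set x : T * {ffun 'I_n -> 'I_K} | Q x.1 [multinom val (x.2 i) | i < n]]|.
Proof.
move=> QK; set A := [set x | _].
apply: (@has_dim_monomials _ _ _
  (fun i : 'I_#|A| => ((enum_val i).1, [multinom val ((enum_val i).2 k) | k < n]))).
  move=> i j [e1 /eq_in_map e2]; apply: enum_val_inj; apply/eqP.
  rewrite -pair_eqE /pair_eq e1 eqxx /=; apply/eqP/ffunP => k.
  by apply/val_inj/e2; rewrite mem_enum.
move=> t m; split=> [Qtm|[i [<- <-]]]; last first.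
  by have := enum_valP i; rewrite inE.
have mE : [multinom val ([ffun k => Ordinal (QK _ _ Qtm k)] k) | k < n] = m.
  by apply/mnmP => k; rewrite mnmE ffunE.
have xA : (t, [ffun k => Ordinal (QK _ _ Qtm k)]) \in A by rewrite inE /= mE.
by exists (enum_rank_in xA (t, [ffun k => Ordinal (QK _ _ Qtm k)]));
  rewrite enum_rankK_in //= mE.
Qed.

End HomogeneousComponents.

(** * The Koszul differential in coordinates *)

Section KoszulFormula.

Variables N n : nat.
Implicit Types (p : {mpoly rat[n]}) (u v : superpoly n) (S : {set 'I_n}) (i k : 'I_n).

Definition koszul_coef k : {mpoly rat[n]} :=
  \sum_(i : {ffun 'I_N -> 'I_n} | (\sum_(j < N) i j == k)%N) \prod_(j < N) 'X_(i j).

Lemma koszulE u S :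
  koszul N u S = \sum_(i | i \notin S) esign [set i] S * koszul_coef i * u (i |: S).
Proof. by rewrite ffunE. Qed.

Definition sconst p : superpoly n := [ffun S : {set 'I_n} => if S == set0 then p else 0].

Definition sxi_set S : superpoly n := [ffun S' => (S' == S)%:R].

Lemma sconst_mulE p u S : (sconst p * u) S = p * u S.
Proof.
rewrite superpolyM (bigD1 set0) ?sub0set //= ffunE eqxx setD0 esign0l mul1r.
by rewrite big1 ?addr0 // => A /andP[_ /negPf A0]; rewrite ffunE A0 mulr0 mul0r.
Qed.

Lemma sconst_linear : linear sconst.
Proof.
by move=> c p q; apply/ffunP => S; rewrite !ffunE; case: eqP; rewrite ?scaler0 ?addr0.
Qed.

HB.instance Definition _ :=
  GRing.isLinear.Build rat {mpoly rat[n]} (superpoly n) *:%R sconst sconst_linear.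

Lemma sconst_monoid_morphism : monoid_morphism sconst.
Proof.
split; first by apply/ffunP => S; rewrite !ffunE; case: eqP.
by move=> p q; apply/ffunP => S; rewrite sconst_mulE !ffunE; case: eqP; rewrite ?mulr0.
Qed.

HB.instance Definition _ :=
  GRing.isMonoidMorphism.Build {mpoly rat[n]} (superpoly n) sconst sconst_monoid_morphism.

Lemma has_parity_sconst p : has_parity false (sconst p).
Proof. by move=> S; rewrite ffunE; case: (S =P set0) => [->|_]; rewrite ?cards0 ?eqxx. Qed.

Lemma has_parity_sxi i : has_parity true (sxi i).
Proof. by move=> S; rewrite ffunE; case: (S =P [set i]) => [->|_]; rewrite ?cards1 ?eqxx. Qed.

Lemma superpoly_sum_sxi_set u : u = \sum_S sconst (u S) * sxi_set S.
Proof.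
apply/ffunP => S; rewrite sum_ffunE (bigD1 S) //= sconst_mulE ffunE eqxx mulr1.
rewrite big1 ?addr0 // => S' /negPf S'S.
by rewrite sconst_mulE ffunE eq_sym S'S mulr0.
Qed.

(** The sign of the product xi_i xi_S is its own inverse, so it can stand on either side. *)
Lemma sxi_setU1 i S : i \notin S ->
  sxi_set (i |: S) = sconst (esign [set i] S) * (sxi i * sxi_set S).
Proof.
move=> iS; apply/ffunP => S'; rewrite sconst_mulE superpolyM ffunE.
case: eqP => [->|ne].
  rewrite (bigD1 [set i]) ?sub1set ?setU11 //= !ffunE eqxx.
  have -> : (i |: S) :\ i = S by rewrite setU1K.
  rewrite eqxx !mulr1 big1 ?addr0 ?esign_sqr // => A /andP[_ /negPf Ai].
  by rewrite ffunE Ai mulr0 mul0r.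
rewrite big1 ?mulr0 // => A sA; rewrite !ffunE.
case: eqP => [Ai|_]; last by rewrite mulr0 mul0r.
case: eqP => [eS|_]; last by rewrite mulr0.
case: ne; by rewrite -eS Ai setD1K // -sub1set -Ai.
Qed.

Lemma koszul_sconst_mul p u : koszul N (sconst p * u) = sconst p * koszul N u.
Proof.
apply/ffunP => S; rewrite sconst_mulE !koszulE mulr_sumr.
by apply: eq_bigr => i _; rewrite sconst_mulE mulrCA.
Qed.

Lemma koszul1 : koszul N (1 : superpoly n) = 0.
Proof.
apply/ffunP => S; rewrite koszulE ffunE big1 // => i _; rewrite ffunE.
by rewrite setU_eq0 -cards_eq0 cards1 mulr0.
Qed.

Lemma koszul_sxiE k : koszul N (sxi k) = sconst (koszul_coef k).
Proof.
apply/ffunP => S; rewrite koszulE ffunE; case: eqP => [->|/eqP S0].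
  rewrite (bigD1 k) ?inE //= ffunE setU0 eqxx esign0r mul1r mulr1.
  by rewrite big1 ?addr0 // => i /andP[_ /negPf ik];
    rewrite ffunE setU0 (inj_eq set1_inj) ik mulr0.
rewrite big1 // => i iS; rewrite ffunE; case: eqP => [e|_]; last by rewrite mulr0.
have := cardsU1 i S; rewrite iS e cards1 => -[] /esym/eqP.
by rewrite cards_eq0 (negPf S0).
Qed.

Variable d : {linear superpoly n -> superpoly n}.
Hypothesis dP : is_koszul_differential N d.

(** The x_k are even cycles, so by the Leibniz rule d commutes with multiplication by each of them,
    hence by monomials and, by linearity, by all polynomials. *)
Lemma koszul_differential_sconst_mul p u : d (sconst p * u) = sconst p * d u.
Proof.
pose P p := forall u, d (sconst p * u) = sconst p * d u.
have P1 : P 1 by move=> v; rewrite rmorph1 !mul1r.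
have PM q r : P q -> P r -> P (q * r).
  by move=> Pq Pr v; rewrite rmorphM -!mulrA Pq Pr.
have PX k : P 'X_k.
  (* [sconst 'X_k] and [sx k] are convertible. *)
  have -> : P 'X_k = forall u, d (sx k * u) = sx k * d u by [].
  move=> v; rewrite (koszul_leibniz dP v (has_parity_sconst (p := 'X_k))).
  by rewrite (koszul_sx dP) mul0r add0r mul1r.
rewrite (mpolyE p) linear_sum !mulr_suml linear_sum; apply: eq_bigr => m _ /=.
rewrite linearZ -!scalerAl linearZ; congr (_ *: _).
suff : P 'X_[m] by [].
rewrite mpolyXE_id; apply: (big_ind P) => // i _.
by elim: (m i) => [|k IHk]; rewrite ?expr0 ?exprS //; apply: PM.
Qed.

(** The axioms determine d: it is linear over the polynomials, and on xi_S the Leibniz rule computes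
    it by induction on the size of S, one generator being split off each time. *)
Lemma koszul_differentialE : d =1 @koszul N n.
Proof.
(* The Leibniz rule for 1 * 1 reads d 1 = d 1 + d 1. *)
have d1 : d 1 = 0.
  have := koszul_leibniz dP 1 (has_parity_sconst (p := 1)).
  rewrite rmorph1 mulr1 mul1r mul1r mulr1 => /eqP.
  by rewrite -subr_eq0 opprD addrA subrr add0r oppr_eq0 => /eqP.
have d_xi S : d (sxi_set S) = koszul N (sxi_set S).
  elim: {S}#|S| {-2}S (erefl #|S|) => [|r IHr] S.
    move/eqP; rewrite cards_eq0 => /eqP ->.
    have -> : sxi_set set0 = 1 by apply/ffunP => S'; rewrite !ffunE.
    by rewrite d1 koszul1.
  move=> cS; have [i iS] : exists i, i \in S by apply/card_gt0P; rewrite cS.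
  have iS' : i \notin S :\ i by rewrite !inE eqxx.
  have cS' : #|S :\ i| = r by move: cS; rewrite (cardsD1 i) iS => -[].
  rewrite -(setD1K iS) (sxi_setU1 iS') koszul_differential_sconst_mul koszul_sconst_mul.
  rewrite (koszul_leibniz dP _ (@has_parity_sxi i)) (koszulM _ _ (@has_parity_sxi i)).
  rewrite IHr // koszul_sxiE (koszul_sxi dP); congr (_ * (_ * _ + _)).
  by rewrite linear_sum; apply: eq_bigr => f _; rewrite rmorph_prod.
move=> u; rewrite (superpoly_sum_sxi_set u) !linear_sum; apply: eq_bigr => S _ /=.
by rewrite koszul_differential_sconst_mul koszul_sconst_mul d_xi.
Qed.

End KoszulFormula.

(** * Bidegrees *)

Section Bidegree.

Variable n : nat.
Implicit Types (m : 'X_{1..n}) (p q : {mpoly rat[n]}).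

Definition mqdeg m : nat := (\sum_(k < n) m k * (2 * k + 2))%N.
Definition mtdeg m : nat := (\sum_(k < n) m k * (2 * k))%N.

Lemma mqdegD m m' : mqdeg (m + m')%MM = (mqdeg m + mqdeg m')%N.
Proof. by rewrite -big_split; apply: eq_bigr => k _; rewrite mnmDE mulnDl. Qed.

Lemma mtdegD m m' : mtdeg (m + m')%MM = (mtdeg m + mtdeg m')%N.
Proof. by rewrite -big_split; apply: eq_bigr => k _; rewrite mnmDE mulnDl. Qed.

Lemma leq_mnm_mqdeg m k : (m k <= mqdeg m)%N.
Proof.
rewrite /mqdeg (bigD1 k) //=; apply: leq_trans (leq_addr _ _).
by rewrite addn2 leq_pmulr.
Qed.

Definition mbihomog a b p := {in msupp p, forall m, mqdeg m = a /\ mtdeg m = b}.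

Lemma mbihomogC (c : rat) : mbihomog 0 0 c%:MP.
Proof.
move=> m; rewrite msuppC; case: (c == 0); rewrite ?inE // => /eqP ->.
by rewrite /mqdeg /mtdeg !big1 // => k _; rewrite mnm0E.
Qed.

Lemma mbihomogX (k : 'I_n) : mbihomog (2 * k + 2) (2 * k) 'X_k.
Proof.
move=> m; rewrite msuppX inE => /eqP ->; split; rewrite /mqdeg /mtdeg (bigD1 k) //=.
  by rewrite mnm1E eqxx mul1n big1 ?addn0 // => i /negPf ik; rewrite mnm1E eq_sym ik.
by rewrite mnm1E eqxx mul1n big1 ?addn0 // => i /negPf ik; rewrite mnm1E eq_sym ik.
Qed.

Lemma mbihomogM a b a' b' p q : mbihomog a b p -> mbihomog a' b' q ->
  mbihomog (a + a') (b + b') (p * q).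
Proof.
move=> ph qh m /msuppM_le/allpairsP[[m1 m2] /= [/ph[<- <-] /qh[<- <-] ->]].
by rewrite mqdegD mtdegD.
Qed.

Lemma mbihomogD a b p q : mbihomog a b p -> mbihomog a b q -> mbihomog a b (p + q).
Proof. by move=> ph qh m /msuppD_le; rewrite mem_cat => /orP[/ph|/qh]. Qed.

Lemma mbihomog_sum (I : Type) (r : seq I) (P : pred I) a b (F : I -> {mpoly rat[n]}) :
  (forall i, P i -> mbihomog a b (F i)) -> mbihomog a b (\sum_(i <- r | P i) F i).
Proof.
move=> Fh; apply: big_ind => //; first by move=> m; rewrite msupp0.
exact: mbihomogD.
Qed.

(** The shift (i, j) is the bidegree of the basis element that the monomial multiplies. *)
Definition bidegree_pred (i j a b : nat) : pred 'X_{1..n} :=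
  fun m => (mqdeg m + i == a)%N && (mtdeg m + j == b)%N.

(** Multiplication by p moves bidegrees by (c, e). The two arithmetic hypotheses compare the shifts
    in a form that [lia] decides. *)
Lemma mproj_bidegreeM i j a b i' j' a' b' c e p q : mbihomog c e p ->
  (forall x, (c + x + i == a) = (x + i' == a'))%N ->
  (forall x, (e + x + j == b) = (x + j' == b'))%N ->
  mproj (bidegree_pred i j a b) (p * q) = p * mproj (bidegree_pred i' j' a' b') q.
Proof.
move=> ph Hq Ht; apply: mprojM => m m' /ph[mc me].
by rewrite /bidegree_pred mqdegD mtdegD mc me Hq Ht.
Qed.

Section Family.

Variables (T : finType) (dq dt : T -> nat).

(** The family u is read as an element of the free module on generators of bidegrees ([dq t],
    [dt t]). It serves both for the basis xi_S and for the four generators of ker d. *)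
Definition family_bihomog a b (u : {ffun T -> {mpoly rat[n]}}) : Prop :=
  forall t m, m \in msupp (u t) -> (mqdeg m + dq t = a)%N /\ (mtdeg m + dt t = b)%N.

Definition family_proj a b (u : {ffun T -> {mpoly rat[n]}}) :
    {ffun T -> {mpoly rat[n]}} :=
  [ffun t => mproj (bidegree_pred (dq t) (dt t) a b) (u t)].

Lemma family_bihomog_proj a b u : family_bihomog a b (family_proj a b u).
Proof. by move=> t m; rewrite ffunE => /msupp_mproj/andP[/eqP-> /eqP->]. Qed.

Lemma family_proj_id a b u : family_bihomog a b u -> family_proj a b u = u.
Proof.
move=> uh; apply/ffunP => t; rewrite ffunE mproj_id // => m /uh[ma mb].
by rewrite /bidegree_pred ma mb !eqxx.
Qed.

(** Every variable has positive q-degree, so all exponents in q-degree a are at most a, and any [K]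
    above a gives the full count. *)
Lemma has_dim_family_bihomog K a b : (a < K)%N ->
  has_dim (family_bihomog a b)
    #|[set x : T * {ffun 'I_n -> 'I_K} |
        (\sum_(k < n) x.2 k * (2 * k + 2) + dq x.1 == a)%N &&
        (\sum_(k < n) x.2 k * (2 * k) + dt x.1 == b)%N]|.
Proof.
move=> aK; pose Q t := bidegree_pred (dq t) (dt t) a b.
have [|f f_inj fE] := @has_dim_bounded_monomials n T Q K.
  move=> t m /andP[/eqP ma _] i; apply: leq_ltn_trans aK.
  by rewrite -ma (leq_trans (leq_mnm_mqdeg m i)) ?leq_addr.
have -> : [set x : T * {ffun 'I_n -> 'I_K} |
    (\sum_(k < n) x.2 k * (2 * k + 2) + dq x.1 == a)%N &&
    (\sum_(k < n) x.2 k * (2 * k) + dt x.1 == b)%N] =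
  [set x : T * {ffun 'I_n -> 'I_K} | Q x.1 [multinom val (x.2 i) | i < n]].
  apply/setP => x; rewrite !inE /Q /bidegree_pred /mqdeg /mtdeg.
  by congr (_ && _); congr (_ + _ == _)%N; apply: eq_bigr => k _; rewrite mnmE.
exists f => // v; rewrite -fE; split=> vh t m /vh; rewrite /Q /bidegree_pred.
  by case=> -> ->; rewrite !eqxx.
by case/andP=> /eqP -> /eqP ->.
Qed.

End Family.

End Bidegree.

(** * Homogeneity of the Koszul differential *)

Section KoszulHomogeneous.

Variables N n : nat.
Implicit Types (S : {set 'I_n}) (u : superpoly n).

Lemma mbihomog_esign A B : mbihomog 0 0 (esign A B : {mpoly rat[n]}).
Proof.
have -> : esign A B = ((-1) ^+ ninv A B)%:MP by rewrite rmorphXn rmorphN rmorph1.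
exact: mbihomogC.
Qed.

Lemma mbihomog_koszul_coef (k : 'I_n) :
  mbihomog (2 * N + 2 * k) (2 * k) (koszul_coef N k).
Proof.
apply: mbihomog_sum => f /eqP <-.
suff: mbihomog (\sum_(j < N) (2 * f j + 2)) (\sum_(j < N) 2 * f j)
        (\prod_(j < N) 'X_(f j) : {mpoly rat[n]}).
  by rewrite big_split sum_nat_const card_ord /= -!big_distrr /= addnC [(N * _)%N]mulnC.
elim/big_ind3: _ => [|a x p b y q xp yq|j _]; first exact: mbihomogC.
  exact: mbihomogM.
exact: mbihomogX.
Qed.

Definition sxi_qdeg S : nat := (\sum_(k in S) (2 * N + 2 * k))%N.
Definition sxi_tdeg S : nat := (\sum_(k in S) (2 * k + 1))%N.

(** Replacing xi_i by d(xi_i) keeps the q-degree 2N + 2i and lowers the t-degree from 2i + 1 to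
    2i. *)
Lemma koszul_family_proj a b u :
  family_proj sxi_qdeg sxi_tdeg a b (koszul N u) =
  koszul N (family_proj sxi_qdeg sxi_tdeg a b.+1 u : superpoly n).
Proof.
apply/ffunP => S; rewrite ffunE !koszulE linear_sum; apply: eq_bigr => i iS /=.
rewrite ffunE.
have fh := mbihomogM (@mbihomog_esign [set i] S) (@mbihomog_koszul_coef i).
by apply: (mproj_bidegreeM _ fh) => x; rewrite /sxi_qdeg /sxi_tdeg big_setU1 //=; lia.
Qed.

End KoszulHomogeneous.

(** * The coefficients of the differential *)

(** Distinct variables are coprime: a monomial m of q without x_i would give a monomial of x_j q
    without x_i, while x_j q = x_i p. *)
Lemma mpolyX_Gauss (n : nat) (i j : 'I_n) (p q : {mpoly rat[n]}) : i != j ->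
  'X_i * p = 'X_j * q -> exists r, q = 'X_i * r.
Proof.
(* The subtraction of exponents is truncated, hence a true division only once x_i is known to divide
   every monomial of q. *)
move=> ij pq; exists (\sum_(m <- msupp q) q@_m *: 'X_[m - U_(i)]).
rewrite {1}(mpolyE q) mulr_sumr !big_seq; apply: eq_bigr => m mq.
rewrite -scalerAr -mpolyXD addmC submK // lep1mP.
apply: contraL mq => /eqP mi; rewrite -mcoeff_eq0 -(mcoeffMX _ U_(j)) mulrC -pq.
rewrite mcoeff_eq0; apply/negP => /msuppM_le/allpairsP[[m1 m2] /= [m1i _]].
move: m1i; rewrite msuppX inE => /eqP -> /(congr1 (fun m : 'X_{1..n} => m i)).
by rewrite !mnmDE !mnm1E eqxx mi eq_sym (negPf ij).
Qed.

Section GeneratingPolynomial.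

Variable n : nat.

(** The generating polynomial x_0 + x_1 z + x_2 z^2 + ...; the coefficient of z^k in its N-th power
    is d(xi_k). *)
Definition xpoly : {poly {mpoly rat[n]}} := \sum_(k < n) 'X_k *: 'X^k.

Lemma coef_xpoly (k : 'I_n) : xpoly`_k = 'X_k.
Proof.
rewrite coef_sum (bigD1 k) //= coefZ coefXn eqxx mulr1 big1 ?addr0 // => i.
by rewrite -val_eqE eq_sym coefZ coefXn => /negPf ->; rewrite mulr0.
Qed.

Lemma koszul_coefE N (k : 'I_n) : koszul_coef N k = (xpoly ^+ N)`_k.
Proof.
rewrite /koszul_coef -[N in RHS]card_ord -prodr_const bigA_distr_bigA coef_sum big_mkcond.
apply: eq_bigr => f _ /=.
have -> : \prod_(j < N) ('X_(f j) *: 'X^(f j) : {poly {mpoly rat[n]}}) =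
    (\prod_(j < N) 'X_(f j)) *: 'X^(\sum_(j < N) f j).
  by rewrite scaler_prod expr_sum.
by rewrite coefZ coefXn eq_sym; case: eqP; rewrite ?mulr1 ?mulr0.
Qed.

End GeneratingPolynomial.

Notation o0 := (@Ordinal 3 0 isT).
Notation o1 := (@Ordinal 3 1 isT).
Notation o2 := (@Ordinal 3 2 isT).
Notation x0 := ('X_o0 : {mpoly rat[3]}).
Notation x1 := ('X_o1 : {mpoly rat[3]}).
Notation x2 := ('X_o2 : {mpoly rat[3]}).

Lemma big_ord3 (R : Type) (idx : R) (op : Monoid.law idx) (F : 'I_3 -> R) :
  \big[op/idx]_(i < 3) F i = op (F o0) (op (F o1) (F o2)).
Proof.
rewrite !big_ord_recl big_ord0 Monoid.mulm1.
by congr (op (F _) (op (F _) (F _))); apply: val_inj.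
Qed.

Lemma xpoly_exp0 N : (xpoly 3 ^+ N)`_0 = x0 ^+ N.
Proof.
elim: N => [|N IHN]; first by rewrite !expr0 coef1.
by rewrite !exprS coefM big_ord1 IHN (coef_xpoly o0).
Qed.

Lemma xpoly_exp1 N : (xpoly 3 ^+ N.+1)`_1 = N.+1%:R * x0 ^+ N * x1.
Proof.
elim: N => [|N IHN]; first by rewrite expr1 (coef_xpoly o1) expr0 !mul1r.
rewrite exprS coefM 2!big_ord_recl big_ord0 addr0 IHN (coef_xpoly o0) (coef_xpoly o1).
by rewrite xpoly_exp0 -[N.+2]addn1 natrD exprS; ring.
Qed.

Lemma xpoly_exp2 N : (xpoly 3 ^+ N.+2)`_2 =
  x0 ^+ N * (N.+2%:R * x0 * x2 + 'C(N.+2, 2)%:R * x1 ^+ 2).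
Proof.
elim: N => [|N IHN].
  rewrite expr2 coefM 3!big_ord_recl big_ord0 addr0 /=.
  by rewrite (coef_xpoly o0) (coef_xpoly o1) (coef_xpoly o2) binn; ring.
rewrite exprS coefM 3!big_ord_recl big_ord0 addr0 IHN /=.
rewrite (coef_xpoly o0) (coef_xpoly o1) (coef_xpoly o2) xpoly_exp0 xpoly_exp1.
by rewrite (binS N.+2) bin1 -[N.+3]addn1 !natrD !exprS; ring.
Qed.

(** * Syzygies of h_0, h_1, h_2, with N = M + 2 so that x0^(N-2) is x0^M *)

Section Syzygies.

Variable M : nat.
Notation N := M.+2.
Implicit Types p q r a b c : {mpoly rat[3]}.

Let h0 := x0 ^+ 2.
Let h1 := N%:R * x0 * x1.
Let h2 := N%:R * x0 * x2 + 'C(N, 2)%:R * x1 ^+ 2.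
(* (N - 1) / 2 *)
Definition half_predN : {mpoly rat[3]} := (M.+1%:R / 2%:R)%:MP.

Lemma mulN_half : N%:R * half_predN = 'C(N, 2)%:R.
Proof.
rewrite /half_predN -[N%:R]mpolyC_nat -[RHS]mpolyC_nat -mpolyCM; congr (_%:MP).
have := congr1 (fun k => k%:R : rat) (mul_bin_diag N 1).
rewrite /= bin1 !natrM => e; rewrite mulrA e mulrC mulKf //.
Qed.

Lemma koszul_coef_o0 : koszul_coef N o0 = x0 ^+ M * h0.
Proof. by rewrite koszul_coefE xpoly_exp0 -exprD addn2. Qed.

Lemma koszul_coef_o1 : koszul_coef N o1 = x0 ^+ M * h1.
Proof. by rewrite koszul_coefE xpoly_exp1 exprS /h1; ring. Qed.

Lemma koszul_coef_o2 : koszul_coef N o2 = x0 ^+ M * h2.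
Proof. by rewrite koszul_coefE xpoly_exp2. Qed.

Lemma natr_mpoly_inv k p : (0 < k)%N -> exists q, p = k%:R * q.
Proof.
move=> k0; exists (k%:R^-1 *: p); rewrite -mpolyC_nat mul_mpolyC scalerA mulfV ?scale1r //.
by rewrite pnatr_eq0 -lt0n.
Qed.

Lemma x0_neq0 : x0 != 0.
Proof.
apply/eqP => /mpolyP/(_ U_(o0)%MM)/eqP.
by rewrite mcoeffX eqxx mcoeff0 oner_eq0.
Qed.

Lemma natr_mpoly_neq0 k : (0 < k)%N -> k%:R != 0 :> {mpoly rat[3]}.
Proof. by move=> k0; rewrite -mpolyC_nat mpolyC_eq0 pnatr_eq0 -lt0n. Qed.

Lemma x0_dvd_natM k p q : (0 < k)%N -> x0 * p = k%:R * q -> exists r, q = x0 * r.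
Proof.
move=> k0; have [s ->] := natr_mpoly_inv p k0; rewrite mulrCA.
by move=> /(mulfI (natr_mpoly_neq0 k0)) <-; exists s.
Qed.

(** Modulo x0, h_2 is C(N,2) x1^2, and x0 is coprime to x1 and to the nonzero rational C(N,2). *)
Lemma x0_dvd_h2 p q : x0 * p = h2 * q -> exists r, q = x0 * r.
Proof.
move=> e.
have [|r1 e1] := @mpolyX_Gauss 3 o0 o1 (p - N%:R * x2 * q) (x1 * ('C(N, 2)%:R * q)) isT.
  by rewrite mulrBr e /h2; ring.
have [|r2 e2] := @mpolyX_Gauss 3 o0 o1 r1 ('C(N, 2)%:R * q) isT; first by rewrite e1.
by apply: (@x0_dvd_natM 'C(N, 2) r2); rewrite ?bin_gt0.
Qed.

(** The columns (N x1, -x0, 0) and (N x2, (N-1)/2 x1, -x0) generate the syzygies. As x0 divides h_0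
    and h_1, it divides c, which gives q; subtracting q times the second column leaves a multiple of
    the first. *)
Lemma syzygy1 a b c : h0 * a + h1 * b + h2 * c = 0 ->
  exists p q, [/\ a = N%:R * x1 * p + N%:R * x2 * q,
                  b = half_predN * x1 * q - x0 * p & c = - x0 * q].
Proof.
move=> e.
have [|q' ec] := @x0_dvd_h2 (- (x0 * a + N%:R * x1 * b)) c.
  by apply/eqP; rewrite -subr_eq0 -oppr_eq0 -{}e /h0 /h1; apply/eqP; ring.
pose q := - q'; pose b' := b - half_predN * x1 * q.
have [p' eb] : exists p', b' = x0 * p'.
  (* Divided by x0, the relation becomes x0 (a - N x2 q) + N x1 b' = 0. *)
  have [|r er] := @mpolyX_Gauss 3 o0 o1 (- (a - N%:R * x2 * q)) (N%:R * b') isT; last first.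
    by apply: (@x0_dvd_natM N r).
  apply: (mulfI x0_neq0); apply/eqP; rewrite -subr_eq0 -oppr_eq0; apply/eqP.
  rewrite -{}e ec /b' /q /h0 /h1 /h2 -mulN_half; ring.
exists (- p'), q; split; last by rewrite ec /q; ring.
  (* Multiplied by h_0 = x0^2, the formula for a follows from the relation itself. *)
  apply: (mulfI x0_neq0); apply: (mulfI x0_neq0).
  apply/eqP; rewrite -subr_eq0; apply/eqP; rewrite -{}e ec.
  have -> : b = x0 * p' + half_predN * x1 * q by rewrite -eb /b' subrK.
  rewrite /q /h0 /h1 /h2 -mulN_half; ring.
by rewrite [x0 * - p']mulrN opprK -eb /b' addrC subrK.
Qed.

(** Applying [x0_dvd_h2] twice to x0 (x0 a) = h_2 c shows that h_0 = x0^2 divides c; a and b then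
    follow by cancelling h_0. *)
Lemma syzygy2 a b c : h0 * a = h2 * c -> h0 * b = - (h1 * c) ->
  exists r, [/\ a = h2 * r, b = - (h1 * r) & c = h0 * r].
Proof.
move=> ea eb.
have [s es] : exists s, c = x0 * s.
  by apply: (@x0_dvd_h2 (x0 * a)); rewrite mulrA.
have [r er] : exists r, s = x0 * r.
  apply: (@x0_dvd_h2 a); apply: (mulfI x0_neq0).
  by rewrite mulrA -[x0 * x0]/h0 ea es; ring.
have h0_neq0 : h0 != 0 by rewrite expf_neq0 ?x0_neq0.
exists r; split; last by rewrite es er /h0; ring.
  by apply: (mulfI h0_neq0); rewrite ea es er /h0; ring.
by apply: (mulfI h0_neq0); rewrite eb es er /h0; ring.
Qed.

End Syzygies.

(** * Cycles for n = 3 *)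

(** Membership bits reduce statements about subsets of the three indices to eight computable
    cases. *)
Definition set3 (b0 b1 b2 : bool) : {set 'I_3} :=
  [set i : 'I_3 | nth false [:: b0; b1; b2] i].

Lemma set3E (S : {set 'I_3}) : S = set3 (o0 \in S) (o1 \in S) (o2 \in S).
Proof.
apply/setP => -[[|[|[|i]]] // lti]; rewrite inE /=; congr (_ \in S); exact: val_inj.
Qed.

Lemma big_set3 (R : Type) (idx : R) (op : Monoid.law idx) b0 b1 b2 (F : 'I_3 -> R) :
  \big[op/idx]_(i in set3 b0 b1 b2) F i =
  op (if b0 then F o0 else idx)
     (op (if b1 then F o1 else idx) (if b2 then F o2 else idx)).
Proof. by rewrite big_mkcond big_ord3 !inE. Qed.

Lemma setU1_set3 b0 b1 b2 :
  (o0 |: set3 b0 b1 b2 = set3 true b1 b2) *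
  (o1 |: set3 b0 b1 b2 = set3 b0 true b2) *
  (o2 |: set3 b0 b1 b2 = set3 b0 b1 true).
Proof.
by split; first split; apply/setP => -[[|[|[|i]]] // lti]; rewrite !inE.
Qed.

Lemma esign_set3 b0 b1 b2 :
  (esign [set o0] (set3 b0 b1 b2) = 1) *
  (esign [set o1] (set3 b0 b1 b2) = (-1) ^+ b0) *
  (esign [set o2] (set3 b0 b1 b2) = (-1) ^+ (b0 + b1)).
Proof.
rewrite /esign /ninv !big_set1 !big_set3 /=.
by split; first split; case: b0; case: b1; case: b2; rewrite /= ?addn0 ?expr0.
Qed.

Lemma koszul_set3 N (u : superpoly 3) b0 b1 b2 :
  koszul N u (set3 b0 b1 b2) =
  (if b0 then 0 else koszul_coef N o0 * u (set3 true b1 b2)) +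
  ((if b1 then 0 else (-1) ^+ b0 * koszul_coef N o1 * u (set3 b0 true b2)) +
   (if b2 then 0 else (-1) ^+ (b0 + b1) * koszul_coef N o2 * u (set3 b0 b1 true))).
Proof.
rewrite koszulE big_mkcond big_ord3 !inE /= !setU1_set3 !esign_set3 mul1r.
by case: b0; case: b1; case: b2.
Qed.

Lemma koszul_koszul N (u : superpoly 3) : koszul N (koszul N u) = 0.
Proof.
apply/ffunP => S; rewrite (set3E S) !koszul_set3 [RHS]ffunE.
by case: (o0 \in S); case: (o1 \in S); case: (o2 \in S) => /=; rewrite ?addn0; ring.
Qed.

Section CycleParametrization.

Variable M : nat.
Notation N := M.+2.

Notation t0 := (@Ordinal 4 0 isT).
Notation t1 := (@Ordinal 4 1 isT).
Notation t2 := (@Ordinal 4 2 isT).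
Notation t3 := (@Ordinal 4 3 isT).
Notation family4 := {ffun 'I_4 -> {mpoly rat[3]}}.
Implicit Types (p : family4) (u : superpoly 3).

(** The combination of the four generating cycles with coefficients p, written out on the basis
    xi_S. *)
Definition cycle_param_fun p : superpoly 3 :=
  [ffun S : {set 'I_3} => match o0 \in S, o1 \in S, o2 \in S return {mpoly rat[3]} with
    | false, false, false => p t0
    | true, false, false => N%:R * x1 * p t1 + N%:R * x2 * p t2
    | false, true, false => half_predN M * x1 * p t2 - x0 * p t1
    | false, false, true => - x0 * p t2
    | true, true, false => (N%:R * x0 * x2 + 'C(N, 2)%:R * x1 ^+ 2) * p t3
    | true, false, true => - (N%:R * x0 * x1 * p t3)
    | false, true, true => x0 ^+ 2 * p t3
    | true, true, true => 0
    end].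

Lemma cycle_param_linear : linear cycle_param_fun.
Proof.
move=> c p q; apply/ffunP => S; rewrite !ffunE.
case: (o0 \in S); case: (o1 \in S); case: (o2 \in S);
  rewrite -!mul_mpolyC; ring.
Qed.

HB.instance Definition _ :=
  GRing.isLinear.Build rat family4 (superpoly 3) *:%R cycle_param_fun cycle_param_linear.

Definition cycle_param : {linear family4 -> superpoly 3} := cycle_param_fun.

(** The components at 1, xi_2, xi_1 and xi_1 xi_2, taken in this order, form a triangular system
    with diagonal 1, -x0, -x0, x0^2. *)
Lemma cycle_param_inj : injective cycle_param.
Proof.
suff ker0 r : cycle_param r = 0 -> r = 0.
  by move=> p q pq; apply/eqP; rewrite -subr_eq0 [_ - _]ker0 // linearB pq subrr.
move=> r0.
have rS b0 b1 b2 : cycle_param r (set3 b0 b1 b2) = 0 by rewrite r0 ffunE.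
have e0 := rS false false false; have e2 := rS false false true.
have e1 := rS false true false; have e3 := rS false true true.
rewrite !ffunE !inE /= in e0 e1 e2 e3.
have x_neq0 := x0_neq0.
move/eqP: e2; rewrite mulNr oppr_eq0 mulf_eq0 (negPf x_neq0) /= => /eqP e2.
move/eqP: e1; rewrite e2 mulr0 sub0r oppr_eq0 mulf_eq0 (negPf x_neq0) /= => /eqP e1.
move/eqP: e3; rewrite mulf_eq0 expf_eq0 (negPf x_neq0) /= => /eqP e3.
by apply/ffunP => -[[|[|[|[|i]]]] // lti]; rewrite [RHS]ffunE;
  [rewrite -[RHS]e0 | rewrite -[RHS]e1 | rewrite -[RHS]e2 | rewrite -[RHS]e3];
  congr (fun_of_fin r _); apply: val_inj.
Qed.

Lemma koszul_cycle_param p : koszul N (cycle_param p) = 0.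
Proof.
apply/ffunP => S; rewrite (set3E S) koszul_set3 [RHS]ffunE !ffunE !inE /=.
rewrite koszul_coef_o0 koszul_coef_o1 koszul_coef_o2 -mulN_half.
case: (o0 \in S); case: (o1 \in S); case: (o2 \in S) => /=; rewrite ?addn0; ring.
Qed.

(** Once x0^M is cancelled, the exterior degrees separate: degree 0 is free, degree 1 is [syzygy1],
    degree 2 is [syzygy2], and degree 3 vanishes. *)
Lemma koszul_cycleP u : koszul N u = 0 -> exists p, u = cycle_param p.
Proof.
move=> ku; have kS b0 b1 b2 : koszul N u (set3 b0 b1 b2) = 0 by rewrite ku ffunE.
have g_neq0 : x0 ^+ M != 0 by rewrite expf_neq0 ?x0_neq0.
have e0 := kS false false false; have e1 := kS true false false.
have e2 := kS false true false; have e3 := kS false false true.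
have e7 := kS false true true.
rewrite !koszul_set3 /= ?koszul_coef_o0 ?koszul_coef_o1 ?koszul_coef_o2 in e0 e1 e2 e3 e7.
have [|p [q [ea eb ec]]] := @syzygy1 M (u (set3 true false false))
    (u (set3 false true false)) (u (set3 false false true)).
  by apply: (mulfI g_neq0); rewrite mulr0 -[RHS]e0; ring.
have [||r [ea' eb' ec']] := @syzygy2 M (u (set3 true true false))
    (u (set3 true false true)) (u (set3 false true true)).
- apply: (mulfI g_neq0); apply/eqP; rewrite -subr_eq0; apply/eqP.
  by rewrite -[RHS]e2; ring.
- apply: (mulfI g_neq0); apply/eqP; rewrite -subr_eq0; apply/eqP.
  by rewrite -[RHS]e3; ring.
have e7' : u (set3 true true true) = 0.
  move/eqP: e7; rewrite !addr0 !mulf_eq0 (negPf g_neq0) !(negPf x0_neq0) /=.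
  by move/eqP.
exists [ffun t : 'I_4 => nth 0 [:: u (set3 false false false); p; q; r] t].
apply/ffunP => S; rewrite [RHS]ffunE !ffunE /= [S in LHS]set3E.
by case: (o0 \in S); case: (o1 \in S); case: (o2 \in S).
Qed.

(** The bidegrees of 1, x1 xi_0, x2 xi_0 and x0^2 xi_1 xi_2, one term from each generator. *)
Definition cycle_qdeg (t : 'I_4) : nat :=
  nth 0%N [:: 0; 2 * N + 4; 2 * N + 6; 4 * N + 10]%N t.
Definition cycle_tdeg (t : 'I_4) : nat := nth 0%N [:: 0; 3; 5; 8]%N t.

(** The generators are bihomogeneous, so taking a bihomogeneous component commutes with the
    parametrization; each of the eight components is checked separately. *)
Lemma cycle_param_proj a b p :
  family_proj (@sxi_qdeg N 3) (@sxi_tdeg 3) a b (cycle_param p) =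
  cycle_param (family_proj cycle_qdeg cycle_tdeg a b p).
Proof.
have hn k : mbihomog 0 0 (k%:R : {mpoly rat[3]}).
  by rewrite -mpolyC_nat; apply: mbihomogC.
have hX := @mbihomogX 3.
have hNx1 := mbihomogM (hn N) (hX o1); have hNx2 := mbihomogM (hn N) (hX o2).
have hhx1 := mbihomogM (@mbihomogC 3 (M.+1%:R / 2%:R)) (hX o1).
have h0 : mbihomog 4 0 (x0 ^+ 2) := mbihomogM (hX o0) (hX o0).
have h1 := mbihomogM (mbihomogM (hn N) (hX o0)) (hX o1).
have h2 : mbihomog 8 4 (N%:R * x0 * x2 + 'C(N, 2)%:R * x1 ^+ 2).
  apply: mbihomogD (mbihomogM (mbihomogM (hn N) (hX o0)) (hX o2)) _.
  exact: mbihomogM (hn _) (mbihomogM (hX o1) (hX o1)).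
apply/ffunP => S; rewrite ffunE.
have -> : sxi_qdeg N S = ((if o0 \in S then 2 * N else 0) +
   ((if o1 \in S then 2 * N + 2 else 0) + (if o2 \in S then 2 * N + 4 else 0)))%N.
  by rewrite /sxi_qdeg {1}(set3E S) big_set3 /= addn0.
have -> : sxi_tdeg S = ((if o0 \in S then 1 else 0) +
   ((if o1 \in S then 3 else 0) + (if o2 \in S then 5 else 0)))%N.
  by rewrite /sxi_tdeg {1}(set3E S) big_set3.
rewrite [in LHS]ffunE [RHS]ffunE !ffunE /cycle_qdeg /cycle_tdeg /=.
case: (o0 \in S); case: (o1 \in S); case: (o2 \in S) => /=.
- by rewrite linear0.
- by apply: (mproj_bidegreeM _ h2) => x /=; lia.
- by rewrite linearN; congr (- _); apply: (mproj_bidegreeM _ h1) => x /=; lia.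
- rewrite linearD; congr (_ + _).
    by apply: (mproj_bidegreeM _ hNx1) => x /=; lia.
  by apply: (mproj_bidegreeM _ hNx2) => x /=; lia.
- by apply: (mproj_bidegreeM _ h0) => x /=; lia.
- rewrite linearB; congr (_ - _).
    by apply: (mproj_bidegreeM _ hhx1) => x /=; lia.
  by apply: (mproj_bidegreeM _ (hX o0)) => x /=; lia.
- rewrite !mulNr linearN; congr (- _).
  by apply: (mproj_bidegreeM _ (hX o0)) => x /=; lia.
- by [].
Qed.

End CycleParametrization.

(** * Hilbert series *)

Section CycleDimension.

Variables (M : nat) (d : {linear superpoly 3 -> superpoly 3}).
Notation N := M.+2.
Hypothesis dP : is_koszul_differential N d.

Lemma bihomog_cycle a b (v : superpoly 3) :
  (exists2 p, family_bihomog (cycle_qdeg M) cycle_tdeg a b p & v = cycle_param M p) <->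
  d v = 0 /\ bihomog N a b v.
Proof.
rewrite (koszul_differentialE dP); split=> [[p ph ->]|[dv vh]].
  split; first exact: koszul_cycle_param.
  (* [bihomog] is by conversion [family_bihomog] for the bidegrees of the xi_S. *)
  suff: family_bihomog (@sxi_qdeg N 3) (@sxi_tdeg 3) a b (cycle_param M p) by [].
  rewrite -(family_proj_id ph) -cycle_param_proj.
  exact: family_bihomog_proj.
have [p vE] := koszul_cycleP dv.
(* As v is bihomogeneous, projecting its parameters to bidegree (a, b) does not change it. *)
exists (family_proj (cycle_qdeg M) cycle_tdeg a b p).
  exact: family_bihomog_proj.
rewrite -cycle_param_proj -vE.
suff {1}<- : family_proj (@sxi_qdeg N 3) (@sxi_tdeg 3) a b v = v by [].
exact: family_proj_id.
Qed.

Lemma bihomog_koszul a b (v : superpoly 3) :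
  bihomog N a b.+1 v -> bihomog N a b (d v).
Proof.
move=> vh; rewrite (koszul_differentialE dP).
suff: family_bihomog (@sxi_qdeg N 3) (@sxi_tdeg 3) a b (koszul N v) by [].
have {1}<- : family_proj (@sxi_qdeg N 3) (@sxi_tdeg 3) a b.+1 v = v.
  exact: family_proj_id.
rewrite -koszul_family_proj; exact: family_bihomog_proj.
Qed.

Lemma bihomog_boundary a b (v w : superpoly 3) :
  bihomog N a b v -> v = d w -> exists2 w', bihomog N a b.+1 w' & v = d w'.
Proof.
move=> vh vE; exists (family_proj (@sxi_qdeg N 3) (@sxi_tdeg 3) a b.+1 w).
  exact: family_bihomog_proj.
rewrite (koszul_differentialE dP) -koszul_family_proj -(koszul_differentialE dP) -vE.
by apply/esym; exact: family_proj_id.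
Qed.

End CycleDimension.

(** * Truncated power series in q and t *)

Section PoincareSeries.

Implicit Types (p r : {poly {poly int}}) (a b K : nat).

Lemma coef_qt_monomial A B a b :
  (qvar ^+ A * tvar ^+ B)`_a`_b = ((A == a) && (B == b))%:R.
Proof.
rewrite mulrC -polyC_exp coefCM coefXn eq_sym.
by case: eqP => _; rewrite ?mulr1 ?mulr0 ?coef0 // coefXn eq_sym.
Qed.

Definition xweight (k : nat) := qvar ^+ (2 * k + 2) * tvar ^+ (2 * k).

Definition geometric K p := \sum_(j < K) p ^+ j.

(* truncation of the Hilbert series of Q[x_0, .., x_(n-1)] *)
Definition xseries n K := \prod_(k < n) geometric K (xweight k).

(** Expanding the product of geometric sums gives one monomial, with its bidegree, for each
    generator and exponent vector. *)
Lemma card_bounded_monomials n (T : finType) (dq dt : T -> nat) K a b :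
  (#|[set x : T * {ffun 'I_n -> 'I_K} |
        (\sum_(k < n) x.2 k * (2 * k + 2) + dq x.1 == a)%N &&
        (\sum_(k < n) x.2 k * (2 * k) + dt x.1 == b)%N]|)%:Z =
  ((\sum_t qvar ^+ dq t * tvar ^+ dt t) * xseries n K)`_a`_b.
Proof.
rewrite /xseries /geometric bigA_distr_bigA mulr_suml.
under eq_bigr do rewrite mulr_sumr.
rewrite pair_bigA coef_sum coef_sum -sum1_card -natz natr_sum big_mkcond /=.
apply: eq_bigr => -[t f] _; rewrite inE /=.
set A := (\sum_(k < n) _ + _)%N; set B := (\sum_(k < n) _ + _)%N.
have -> : qvar ^+ dq t * tvar ^+ dt t * \prod_(k < n) xweight k ^+ f k =
    qvar ^+ A * tvar ^+ B.
  rewrite /A /B !exprD !expr_sum [RHS]mulrACA mulrC; congr (_ * _).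
  rewrite -big_split; apply: eq_bigr => k _ /=.
  by rewrite exprMn -!exprM mulnC [(2 * k * _)%N]mulnC.
by rewrite coef_qt_monomial; case: (_ && _).
Qed.

Definition eq_coef_upto K p p' := forall i, (i < K)%N -> p`_i = p'`_i.

Lemma eq_coef_uptoM K p p' r r' :
  eq_coef_upto K p p' -> eq_coef_upto K r r' -> eq_coef_upto K (p * r) (p' * r').
Proof.
move=> pp rr i iK; rewrite !coefM; apply: eq_bigr => j _.
by rewrite pp ?rr //; apply: leq_ltn_trans iK; rewrite ?leq_subr // -ltnS.
Qed.

Lemma coef_xweight_exp k j i : (i < j)%N -> (xweight k ^+ j)`_i = 0.
Proof.
move=> ij; apply/polyP => l; rewrite exprMn -!exprM coef_qt_monomial coef0.
by rewrite gtn_eqF //; apply: leq_trans ij _; rewrite leq_pmull // addn2.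
Qed.

Lemma geometric_upto K K' k : (K <= K')%N ->
  eq_coef_upto K (geometric K' (xweight k)) (geometric K (xweight k)).
Proof.
move=> KK i iK; rewrite !coef_sum.
rewrite -!(big_mkord xpredT (fun j => (xweight k ^+ j)`_i)) (big_cat_nat (leq0n K) KK) //=.
rewrite [X in _ + X]big_nat_cond [X in _ + X]big1 ?addr0 // => j /andP[/andP[Kj _] _].
by rewrite coef_xweight_exp // (leq_trans iK).
Qed.

Lemma xseries_upto n K K' : (K <= K')%N ->
  eq_coef_upto K (xseries n K') (xseries n K).
Proof.
move=> KK; apply: (big_ind2 (eq_coef_upto K)) => // [p p' r r'|k _].
  exact: eq_coef_uptoM.
exact: geometric_upto.
Qed.

(** Each factor telescopes to 1 - w^K with w the weight of x_k, and w^K has no term below q^K. *)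
Lemma xseries_inverse n K :
  eq_coef_upto K (xseries n K * \prod_(k < n) (1 - xweight k)) 1.
Proof.
rewrite -big_split /=.
apply: (big_ind (fun p => eq_coef_upto K p 1)) => // [p r p1 r1|k _ i iK].
  by rewrite -[1]mulr1; apply: eq_coef_uptoM.
have -> : geometric K (xweight k) * (1 - xweight k) = 1 - xweight k ^+ K.
  by rewrite -[RHS]opprB subrX1 -[RHS]mulNr mulrC; congr (_ * _); rewrite opprB.
by rewrite coefB coef_xweight_exp // subr0.
Qed.

Lemma series_mul_coefE (P : nat -> nat -> nat) p r a b :
  (forall i j, (i <= a)%N -> (P i j)%:Z = r`_i`_j) ->
  series_mul_coef P p a b = (r * p)`_a`_b.
Proof.
move=> Pr; rewrite coefM coef_sum; apply: eq_bigr => i _; rewrite coefM.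
by apply: eq_bigr => j _; rewrite Pr // -ltnS.
Qed.

End PoincareSeries.

Definition poincare_numerator (N : nat) : {poly {poly int}} :=
  1 - qvar ^+ (2 * N) - qvar ^+ (2 * N + 2) * tvar ^+ 2
  + qvar ^+ (2 * N + 4) * (tvar ^+ 2 + tvar ^+ 3 - tvar ^+ 4)
  + qvar ^+ (2 * N + 6) * (tvar ^+ 4 + tvar ^+ 5)
  - qvar ^+ (4 * N + 2) * tvar ^+ 3 - qvar ^+ (4 * N + 4) * tvar ^+ 5
  - qvar ^+ (4 * N + 6) * tvar ^+ 7
  + qvar ^+ (4 * N + 10) * (tvar ^+ 7 + tvar ^+ 8)
  - qvar ^+ (6 * N + 6) * tvar ^+ 8.

Lemma koszul_series N :
  \sum_(S : {set 'I_3}) qvar ^+ sxi_qdeg N S * tvar ^+ sxi_tdeg S =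
  (1 + qvar ^+ (2 * N) * tvar) * (1 + qvar ^+ (2 * N + 2) * tvar ^+ 3)
  * (1 + qvar ^+ (2 * N + 4) * tvar ^+ 5).
Proof.
have -> : (1 + qvar ^+ (2 * N) * tvar) * (1 + qvar ^+ (2 * N + 2) * tvar ^+ 3)
  * (1 + qvar ^+ (2 * N + 4) * tvar ^+ 5) =
  \prod_(k < 3) (qvar ^+ (2 * N + 2 * k) * tvar ^+ (2 * k + 1) + 1).
  by rewrite big_ord3 /= addn0 expr1; ring.
rewrite bigA_distr; apply: eq_bigr => S _.
by rewrite big_if /= big1_eq mulr1 big_split -!expr_sum.
Qed.

Lemma cycle_series M :
  \sum_(t : 'I_4) qvar ^+ cycle_qdeg M t * tvar ^+ cycle_tdeg t =
  1 + qvar ^+ (2 * M.+2 + 4) * tvar ^+ 3 + qvar ^+ (2 * M.+2 + 6) * tvar ^+ 5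
  + qvar ^+ (4 * M.+2 + 10) * tvar ^+ 8.
Proof.
by rewrite !big_ord_recl big_ord0 /cycle_qdeg /cycle_tdeg /= !expr0 mulr1 addr0 !addrA.
Qed.

(** The identity Z - (C - Z) / t for the numerator, multiplied by t to stay among polynomials. *)
Lemma numerator_decomposition M :
  let Z := \sum_(t : 'I_4) qvar ^+ cycle_qdeg M t * tvar ^+ cycle_tdeg t in
  let C := \sum_(S : {set 'I_3}) qvar ^+ sxi_qdeg M.+2 S * tvar ^+ sxi_tdeg S in
  Z - C = tvar * (poincare_numerator M.+2 - Z).
Proof.
rewrite cycle_series koszul_series /poincare_numerator /=.
set N := M.+2.
(* All exponents are brought to powers of q^(2N), so that [ring] can treat it as an atom. *)
rewrite (_ : 4 * N = 2 * N * 2)%N; last lia.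
rewrite (_ : 6 * N = 2 * N * 3)%N; last lia.
rewrite !exprD !(exprM _ (2 * N)); ring.
Qed.

(** The boundaries in bidegree (a, b) come from (a, b+1), so the dimension is that of the cycles in
    both bidegrees minus that of the complex in (a, b+1). *)
Lemma homology_dim_coef M (d : {linear superpoly 3 -> superpoly 3}) a b :
  is_koszul_differential M.+2 d ->
  exists2 r, homology_dim M.+2 d a b r &
    r%:Z = (poincare_numerator M.+2 * xseries 3 a.+1)`_a`_b.
Proof.
move=> dP.
have hC : has_dim (V := superpoly 3) (bihomog M.+2 a b.+1) _ :=
  has_dim_family_bihomog 3 (@sxi_qdeg M.+2 3) (@sxi_tdeg 3) b.+1 (ltnSn a).
have hZ b' : has_dim (fun v => d v = 0 /\ bihomog M.+2 a b' v) _ :=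
  has_dim_ext (bihomog_cycle dP a b') (has_dim_image (@cycle_param_inj M)
    (has_dim_family_bihomog 3 (cycle_qdeg M) cycle_tdeg b' (ltnSn a))).
have swap v : d v = 0 /\ bihomog M.+2 a b.+1 v <-> bihomog M.+2 a b.+1 v /\ d v = 0.
  by split=> -[].
have [||le_c hH] := subquotient_dim_rank hC (hZ b) (has_dim_ext swap (hZ b.+1)).
- move=> v vh; split; last exact: bihomog_koszul.
  by rewrite !(koszul_differentialE dP) koszul_koszul.
- by move=> v [_ vh] [w vE]; exact: bihomog_boundary vh vE.
eexists; first exact: hH.
rewrite -subzn // PoszD !card_bounded_monomials.
(* Multiplication by t aligns all terms at t^(b+1). *)
have coef_tM p : (tvar * p)`_a`_b.+1 = p`_a`_b by rewrite coefCM coefXM.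
have := numerator_decomposition M; set Z := \sum_t _; set C := \sum_S _ => /= eN.
set R := xseries 3 a.+1; rewrite -[RHS]coef_tM.
have -> : tvar * (poincare_numerator M.+2 * R) = tvar * (Z * R) + Z * R - C * R.
  transitivity (tvar * (poincare_numerator M.+2 - Z) * R + tvar * (Z * R)); first by ring.
  by rewrite -eN; ring.
by rewrite !coefB !coefD coef_tM.
Qed.

Theorem theorem13 (N : nat) (hN : (2 <= N)%N)
    (d : {linear superpoly 3 -> superpoly 3})
    (hd : is_koszul_differential N d) :
  exists P : nat -> nat -> nat,
    is_poincare_series N d P /\
    forall a b : nat,
      series_mul_coef P
        ((1 - qvar ^+ 2) * (1 - qvar ^+ 4 * tvar ^+ 2)
         * (1 - qvar ^+ 6 * tvar ^+ 4)) a b =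
      (1 - qvar ^+ (2 * N) - qvar ^+ (2 * N + 2) * tvar ^+ 2
       + qvar ^+ (2 * N + 4) * (tvar ^+ 2 + tvar ^+ 3 - tvar ^+ 4)
       + qvar ^+ (2 * N + 6) * (tvar ^+ 4 + tvar ^+ 5)
       - qvar ^+ (4 * N + 2) * tvar ^+ 3 - qvar ^+ (4 * N + 4) * tvar ^+ 5
       - qvar ^+ (4 * N + 6) * tvar ^+ 7
       + qvar ^+ (4 * N + 10) * (tvar ^+ 7 + tvar ^+ 8)
       - qvar ^+ (6 * N + 6) * tvar ^+ 8)`_a`_b.
Proof.
case: N hN hd => [|[|M]] // _ dP; pose Num := poincare_numerator M.+2.
(* Truncation at a + 1 is exact for the coefficient of q^a; [absz] changes nothing, since these
   integers are dimensions. *)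
exists (fun a b => absz (Num * xseries 3 a.+1)`_a`_b); split=> a b.
  by have [r rH <-] := homology_dim_coef a b dP; rewrite absz_nat.
rewrite (@series_mul_coefE _ _ (Num * xseries 3 a.+1)) => [|i j ia].
  have -> : (1 - qvar ^+ 2) * (1 - qvar ^+ 4 * tvar ^+ 2) * (1 - qvar ^+ 6 * tvar ^+ 4) =
      \prod_(k < 3) (1 - xweight k).
    by rewrite big_ord3 /xweight /= !expr0 mulr1 mulrA.
  rewrite -mulrA (eq_coef_uptoM (fun _ _ => erefl) (@xseries_inverse 3 a.+1)) //.
  by rewrite mulr1.
have [r _ rE] := homology_dim_coef i j dP; rewrite -rE absz_nat rE.
(* The truncation at i + 1 that defines the value at i is replaced by the common truncation at a +
   1. *)
by rewrite (eq_coef_uptoM (fun _ _ => erefl) (@xseries_upto 3 i.+1 a.+1 ia)).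
Qed.
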